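(* Let $0\le m_2\le m_1$, where $m_2=m_2(m_1)$ may depend on $m_1$, and let $W_{m_1,m_2}$ be the random variable of the card guessing game described in the context. Write $d:=m_1-m_2$. As $m_1\to\infty$, the limiting distribution of $W_{m_1,m_2}$, depending on the growth of $m_2$, is as follows. (1) If $m_2=o(m_1)$: $W_{m_1,m_2}$ converges in distribution to $0$. (2) If $m_2\sim\rho\,m_1$ with $0<\rho<1$: $W_{m_1,m_2}$ converges in distribution to a random variable $X_\rho$ distributed as $\mathrm{Geom}\big(\frac{1-\rho}{1+\rho}\big)-1$, i.e. with probability mass function $$\mathbb{P}\{X_\rho=k\}=\frac{1-\rho}{1+\rho}\Big(\frac{2\rho}{1+\rho}\Big)^k,\qquad k\ge0.$$ (3) If $m_2\sim m_1$ and $\sqrt{m_1}\ll d\ll m_1$: $d\,W_{m_1,m_2}/m_1$ converges in distribution to $X\sim\mathrm{Exp}(1/2)$, i.e. with distribution function $F(x)=1-e^{-x/2}$, $x>0$. (4) If $m_2\sim m_1$ and $d\sim\alpha\sqrt{m_1}$ with $\alpha>0$: $W_{m_1,m_2}/\sqrt{m_1}$ converges in distribution to a random variable $X_\alpha$ with distribution function $F(x)=1-e^{-x(2\alpha+x)/4}$, $x>0$, i.e. $X_\alpha\sim\mathrm{LinExp}(\alpha/2,1/2)$. (5) If $m_2\sim m_1$ and $d=o(\sqrt{m_1})$: $W_{m_1,m_2}/\sqrt{m_1}$ converges in distribution to $X\sim\mathrm{Rayleigh}(\sqrt2)$, i.e. with distribution function $F(x)=1-e^{-x^2/4}$, $x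>0$.
   Context: Card guessing game: a deck consists of $m_1$ cards of one colour (red) and $m_2$ cards of another colour (black), with integers $0\le m_2\le m_1$, in uniformly random order. The cards are drawn from the top one at a time and discarded until the deck is empty. (In the game, before each draw a guesser knowing the numbers of remaining cards of each colour guesses the colour of the next card so as to maximize the probability of being correct.) $W_{m_1,m_2}$ is the number of times during the process (including the initial state) at which the numbers of remaining red and black cards are equal and non-zero. Notation: $f\ll g$ means $f=o(g)$. $\mathrm{Geom}(p)$ has probability mass function $p(1-p)^{\ell-1}$, $\ell\ge1$. $\mathrm{LinExp}(\lambda,\nu)$ has distribution function $1-e^{-(\lambda x+\nu x^2/2)}$, $x>0$. *)

(* Defs.v *)
From HB Require Import structures.
From mathcomp Require Import all_boot all_order all_algebra.
From mathcomp Require Import all_classical all_reals all_analysis finmap.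

Set Implicit Arguments.
Unset Strict Implicit.
Unset Printing Implicit Defensive.

Import Order.TTheory GRing.Theory Num.Theory.
Import numFieldNormedType.Exports.

Local Open Scope classical_set_scope.
Local Open Scope ring_scope.

(* A shuffled deck, listed from the top: [true] is a red card, [false] a black
   one.  Cards of one colour are indistinguishable. *)
Record deck (m1 m2 : nat) := Deck {
  cards :> (m1 + m2).-tuple bool;
  _ : count_mem true cards == m1 }.

HB.instance Definition _ m1 m2 := [isSub for @cards m1 m2].
HB.instance Definition _ m1 m2 := [Finite of deck m1 m2 by <:].

Fact unshuffled_size m1 m2 :
  size (nseq m1 true ++ nseq m2 false) == (m1 + m2)%N.
Proof. by rewrite size_cat !size_nseq. Qed.

Fact unshuffled_count m1 m2 :
  count_mem true (Tuple (unshuffled_size m1 m2)) == m1.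
Proof. by rewrite /= count_cat !count_nseq /= mul1n mul0n addn0. Qed.

Definition unshuffled m1 m2 : deck m1 m2 := Deck (unshuffled_count m1 m2).

HB.instance Definition _ m1 m2 := isPointed.Build (deck m1 m2) (unshuffled m1 m2).
HB.instance Definition _ m1 m2 := @isMeasurable.Build default_measure_display
  (deck m1 m2) discrete_measurable discrete_measurable0
  discrete_measurableC discrete_measurableU.

(* The uniform distribution; the last argument of [mnormalize] is its fallback
   for a measure of mass 0 or +oo, which [uniform_deckE] shows is not used. *)
Definition uniform_deck (R : realType) (m1 m2 : nat) :
    probability (deck m1 m2) R :=
  mnormalize (@counting (deck m1 m2) R) (\d_(unshuffled m1 m2)).

Lemma uniform_deckE (R : realType) (m1 m2 : nat) (t : deck m1 m2) :
  uniform_deck R m1 m2 [set t] = (#|{: deck m1 m2}|%:R^-1)%:E.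
Proof.
have cT : @counting (deck m1 m2) R setT = #|{: deck m1 m2}|%:R%:E.
  rewrite /counting asboolT; last exact: finite_finset.
  suff -> : fset_set [set: deck m1 m2] = [fset x in enum {: deck m1 m2}]%fset.
    by rewrite card_fseq undup_id ?enum_uniq// cardE.
  apply/fsetP => x; rewrite in_fset_set; last exact: finite_finset.
  by rewrite in_setT !inE mem_enum.
have c1 : @counting (deck m1 m2) R [set t] = 1%:E.
  by rewrite /counting asboolT ?fset_set1 ?cardfs1.
have n0 : (#|{: deck m1 m2}|%:R : R) != 0.
  by rewrite pnatr_eq0 -lt0n; apply/card_gt0P; exists t.
by rewrite /uniform_deck /= /mnormalize /= cT eqe (negbTE n0) /= c1 mul1e.
Qed.

(* After [j] draws, [drop j t] is what is left of the deck [t]. *)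
Definition remaining m1 m2 (c : bool) (t : deck m1 m2) (j : nat) : nat :=
  count_mem c (drop j t).

Definition matches m1 m2 (t : deck m1 m2) : nat :=
  #|[pred j : 'I_(m1 + m2).+1 |
      (remaining true t j == remaining false t j) && (remaining true t j != 0%N)]|.

Section W.
Context (R : realType) (m1 m2 : nat).

Definition matchesR (t : deck m1 m2) : R := (matches t)%:R.

Fact measurable_matchesR : measurable_fun [set: deck m1 m2] matchesR.
Proof. by []. Qed.

HB.instance Definition _ := isMeasurableFun.Build _ _ _ _ matchesR
  measurable_matchesR.

Definition W : {RV (uniform_deck R m1 m2) >-> R} := matchesR.

End W.

(* Convergence in distribution; each [X n] may live on its own space. *)
Definition cvg_in_distribution (R : realType)
    (d : nat -> measure_display) (T : forall n, measurableType (d n))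
    (P : forall n, probability (T n) R) (X : forall n, {RV (P n) >-> R})
    (d' : measure_display) (T' : measurableType d') (Q : probability T' R)
    (Y : {RV Q >-> R}) : Prop :=
  forall x : R, {for x, continuous (cdf Y)} ->
    cdf (X n) x @[n --> \oo] --> cdf Y x.

Section real_random_variables.
Context (R : realType) (d : measure_display) (T : measurableType d)
  (Q : probability T R) (X : {RV Q >-> R}).

Definition scale_RV (c : R) : {RV Q >-> R} := c *: (X : {mfun T >-> R}).

Lemma scale_RVE (c : R) (t : T) : scale_RV c t = c * X t.
Proof. by []. Qed.

Definition Geom (p : R) : Prop :=
  forall l : nat, (1 <= l)%N -> pmf X l%:R = p * (1 - p) ^+ (l - 1).

Definition Exp (lambda : R) : Prop :=
  forall A : set R, measurable A -> distribution Q X A = exponential_prob lambda A.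

(* The values of a distribution function on x > 0 determine it when, as below,
   it tends to 0 at 0+. *)
Definition LinExp (lambda nu : R) : Prop := forall x : R, 0 < x ->
  cdf X x = (1 - expR (- (lambda * x + nu * x ^+ 2 / 2)))%:E.

Definition Rayleigh (sigma : R) : Prop := forall x : R, 0 < x ->
  cdf X x = (1 - expR (- (x ^+ 2 / (2 * sigma ^+ 2))))%:E.

End real_random_variables.

(* Main.v *)
From HB Require Import structures.
Require Import Defs.
From mathcomp Require Import all_boot all_order all_algebra.
From mathcomp Require Import all_classical all_reals all_analysis.
From mathcomp Require Import measurable_realfun finmap.
From mathcomp Require Import zify ring lra.

(** The number of ties has an explicit tail.  A first-card recursion shows that
    2 ^ k 'C(m1 + m2 - k, m1) of the 'C(m1 + m2, m1) decks have at least [k]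
    ties ([card_deck_ties]); the mechanism is that a tie can be left with
    either colour, and that forcing one more tie thus costs one card and
    gains a factor 2.  Dividing and telescoping ([tail_binomial]), with
    d = m1 - m2,

      P(W >= k) = \prod_(j < k) 2 (m2 - j) / (m1 + m2 - j)
                = \prod_(j < k) (1 - (d + j) / (m1 + m2 - j)).

    Everything else is the asymptotics of this product.

    When m2 / m1 tends to rho < 1 and [k] is fixed, each factor tends to
    2 rho / (1 + rho), so the tail becomes geometric
    ([cvg_tail_geometric]); rho = 0 is the degenerate limit.

    When m2 / m1 tends to 1, the factors tend to 1, and bounding 1 - u above by
    exp (- u) and below by exp (- u / (1 - u)) squeezes the product between
    exponentials whose exponents both have the limit of
    - (k d + k ^ 2 / 2) / (2 m1) ([tail_bounds]).  With k close to x s, where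
    [s] is the scale of W, the limit is exp (- (a x / 2 + b x ^ 2 / 4)) with
    a = lim s d / m1 and b = lim s ^ 2 / m1 ([cvg_tail_scaled]).  The scale
    s = m1 / d gives (a, b) = (1, 0), the exponential law; the scale
    s = sqrt m1 gives (a, b) = (alpha, 1), the linear-exponential law, which
    is the Rayleigh law for alpha = 0.

    The limit variables all live on the real line with the exponential
    probability of rate 1/2, as nondecreasing functions of the identity: the
    identity itself, the positive root of x (2 alpha + x) = 2 e, and the integer
    part (rounded up) of a multiple of e. *)

Set Implicit Arguments.
Unset Strict Implicit.
Unset Printing Implicit Defensive.

Import Order.TTheory GRing.Theory Num.Theory.
Import numFieldNormedType.Exports.

(** * Counting decks by their number of ties *)

(** The structural form of [matches]: a nonempty suffix with equally many cards
    of both colours automatically has some card of each. *)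
Fixpoint ties (s : seq bool) : nat :=
  if s is _ :: s' then (count_mem true s == count_mem false s) + ties s' else 0.

Lemma count_memTF (s : seq bool) : count_mem true s + count_mem false s = size s.
Proof. by elim: s => //= -[] s <- /=; lia. Qed.

Lemma matchesE m1 m2 (t : deck m1 m2) : matches t = ties t.
Proof.
suff tiesE (s : seq bool) : ties s = \sum_(j < (size s).+1)
    ((count_mem true (drop j s) == count_mem false (drop j s)) &&
      (count_mem true (drop j s) != 0)).
  rewrite /matches -sum1_card big_mkcond/= tiesE size_tuple.
  by apply: eq_bigr => j _; rewrite inE; case: ifP.
elim: s => [|c s IHs]; first by rewrite big_ord_recl big_ord0.
rewrite big_ord_recl drop0 [LHS]/= IHs; congr (nat_of_bool _ + _).
have := count_memTF (c :: s); rewrite [size _]/=.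
by case: eqP => //= <-; lia.
Qed.

(** Fixing the length and the number of reds, rather than both colour counts,
    makes removing the first card a recursion on the length alone. *)
Definition words (n a k : nat) : nat :=
  #|[pred t : n.-tuple bool | (count_mem true t == a) && (k <= ties t)]|.

Lemma words0 a k : words 0 a k = (a == 0) && (k == 0).
Proof.
rewrite /words (eq_card (B := [pred t : 0.-tuple bool | (a == 0) && (k == 0)])).
  case: (_ && _); last exact: card0.
  by rewrite (eq_card (B := predT)) // card_tuple expn0.
by move=> t; rewrite tuple0 !inE /= leqn0 eq_sym.
Qed.

Lemma words_gt n a k : n < a -> words n a k = 0.
Proof.
move=> na; apply: eq_card0 => t; rewrite !inE; apply/negbTE.
have : count_mem true t <= n by rewrite -[X in _ <= X](size_tuple t) count_size.
by case: eqP na => [<-|//]; rewrite ltnNge => /negP.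
Qed.

(** Condition on the first card.  The whole deck is itself a tie exactly when
    twice the number of reds is the length, and then one tie fewer is required
    of the rest. *)
Lemma wordsS n a k : words n.+1 a k =
  (if a is a'.+1 then words n a' (k - (a.*2 == n.+1)) else 0)
    + words n a (k - (a.*2 == n.+1)).
Proof.
pose W c := [pred t : n.-tuple bool |
  (count_mem true (c :: t) == a) && (k <= ties (c :: t))].
have cons_bij : bijective (fun p : bool * n.-tuple bool =>
    [tuple of p.1 :: p.2]).
  exists (fun t : n.+1.-tuple bool => (thead t, [tuple of behead t])).
    by case=> c t; congr pair; apply: val_inj.
  by move=> t; rewrite -tuple_eta.
have -> : words n.+1 a k = #|W true| + #|W false|.
  rewrite /words -!sum1_card !(big_mkcond (W _)) /=.
  rewrite big_mkcond (reindex _ (onW_bij _ cons_bij)) /=.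
  by rewrite -(pair_bigA _ (fun c t => if t \in W c then 1 else 0)) big_bool.
have WE (c : bool) : c + (a - c) = a ->
    #|W c| = words n (a - c) (k - (a.*2 == n.+1)).
  move=> ca; apply: eq_card => t; rewrite !inE leq_subLR.
  have := count_memTF (c :: t); rewrite [size _]/= size_tuple => nE.
  have -> : (count_mem true t == a - c) = (count_mem true (c :: t) == a).
    by rewrite /= eqb_id; lia.
  rewrite -[ties (c :: t)]/((count_mem true (c :: t) ==
    count_mem false (c :: t)) + ties t).
  move: (count_mem true _) (count_mem false _) nE => p q pq.
  by case: eqP => //= <-; congr (_ <= nat_of_bool _ + _); lia.
congr (_ + _); last by rewrite WE ?subn0.
case: a @W WE => [|a] W WE; last by rewrite WE ?subn1 /= ?subn1.
by apply: eq_card0 => t; rewrite !inE.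
Qed.

(** Away from a tie the claim is Pascal's rule, since a card of the majority
    colour lowers the maximum by one and a card of the minority colour keeps it.
    At a tie both colours leave the same maximum, so the two branches add up to
    the factor 2 that pays for the tie.  The formula fails only for the empty
    deck, which has no tie although 2 ^ k * 'C(0, 0) is positive. *)
Lemma card_words n a k : a <= n.+1 ->
  words n.+1 a k = 2 ^ k * 'C(n.+1 - k, maxn a (n.+1 - a)).
Proof.
elim: n a k => [|n IHn] a k an.
  rewrite wordsS !words0; case: a an => [|[|a]] _; case: k => [|k] //=;
    by rewrite ?subn0 ?words0 // bin_small ?muln0; lia.
rewrite wordsS.
have pascal M : 0 < M ->
    'C(n.+1 - k, M.+1) + 'C(n.+1 - k, M) = 'C(n.+2 - k, M.+1).
  move=> M0; have [kn|kn] := leqP k n.+1; first by rewrite (subSn kn) binS.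
  by rewrite !bin_small //; lia.
case: (ltngtP a.*2 n.+2) => [lt2a|gt2a|eq2a]; rewrite ?subn0.
- have -> : maxn a (n.+2 - a) = (n.+1 - a).+1 by lia.
  rewrite -pascal; last lia.
  rewrite mulnDr IHn; last lia.
  congr (_ + _ * 'C(_, _)); last lia.
  case: a an lt2a => [|a] an lt2a; first by rewrite bin_small ?muln0 //; lia.
  by rewrite IHn; [congr (_ * 'C(_, _))|]; lia.
- case: a an gt2a => // a an gt2a.
  have -> : maxn a.+1 (n.+2 - a.+1) = a.+1 by lia.
  rewrite -pascal; last lia.
  rewrite mulnDr addnC (IHn a); last lia.
  rewrite [maxn _ _](_ : _ = a); last lia.
  congr (_ + _); have [an1|an1] := leqP a.+1 n.+1.
    by rewrite IHn //; congr (_ * 'C(_, _)); lia.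
  by rewrite words_gt // bin_small ?muln0; lia.
case: a an eq2a => // a an eq2a; rewrite !IHn; try lia.
have -> : maxn a (n.+1 - a) = a.+1 by lia.
have -> : maxn a.+1 (n.+1 - a.+1) = a.+1 by lia.
have -> : maxn a.+1 (n.+2 - a.+1) = a.+1 by lia.
(* With no tie required there is no tie to pay for: Pascal's rule and the
   symmetry of the central binomial coefficient apply instead. *)
case: k {pascal} => [|k]; last by rewrite subn1 /= subSS expnS -mulnA mul2n addnn.
rewrite !expn0 !mul1n !subn0 [RHS]binS; congr (_ + _).
by rewrite -[RHS]bin_sub; [congr 'C(_, _)|]; lia.
Qed.

Lemma card_deck_ties m1 m2 k : 0 < m1 -> m2 <= m1 ->
  #|[pred t : deck m1 m2 | k <= matches t]| = 2 ^ k * 'C(m1 + m2 - k, m1).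
Proof.
move=> m10 m21; have -> : #|[pred t : deck m1 m2 | k <= matches t]| =
    words (m1 + m2) m1 k.
  rewrite -(fintype.card_image (@val_inj _ _ (deck m1 m2))); apply: eq_card => t.
  rewrite !inE; apply/fintype.imageP/andP => [[u]|[tm kt]].
    by rewrite inE matchesE => ku ->; split=> //; case: u {ku}.
  by exists (Deck tm); rewrite // inE matchesE.
case: m1 m10 m21 => // m1 _ m21; rewrite addSn card_words; last lia.
by congr (_ * 'C(_, _)); lia.
Qed.

(** * The tail and the distribution function *)

Local Open Scope classical_set_scope.
Local Open Scope ring_scope.

(** The probability of at least [k] ties.  The truncated subtraction makes it
    vanish for [k > m2], as it should. *)
Definition ties_tail (R : realType) (m1 m2 k : nat) : R :=
  \prod_(j < k) (2 * (m2 - j)%:R / (m1 + m2 - j)%:R).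

Lemma tail_binomial (R : realType) m1 m2 k : (0 < m1)%N ->
  ties_tail R m1 m2 k = (2 ^ k * 'C(m1 + m2 - k, m1))%:R / 'C(m1 + m2, m1)%:R.
Proof.
move=> m10; elim: k => [|k IHk].
  rewrite /ties_tail big_ord0 subn0 mul1n divff// pnatr_eq0 -lt0n bin_gt0; lia.
rewrite /ties_tail big_ord_recr/= -/(ties_tail R m1 m2 k) IHk subnS.
have [kn|kn] := ltnP k (m1 + m2); last first.
  have -> : (m1 + m2 - k = 0)%N by lia.
  by rewrite [_.-1]/= (@bin_small 0)// !muln0 !mul0r.
have := mul_bin_down (m1 + m2 - k) m1.
have -> : (m1 + m2 - k - m1 = m2 - k)%N by lia.
move=> /(congr1 (fun n => n%:R : R)); rewrite !natrM.
have : (m1 + m2 - k)%:R != 0 :> R by rewrite pnatr_eq0; lia.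
have : 'C(m1 + m2, m1)%:R != 0 :> R by rewrite pnatr_eq0 -lt0n bin_gt0; lia.
rewrite !natrX exprS => N0 a0 E.
transitivity (2 * 2 ^+ k * ((m2 - k)%:R * 'C(m1 + m2 - k, m1)%:R) /
  ('C(m1 + m2, m1)%:R * (m1 + m2 - k)%:R) : R); first by field; rewrite ?N0 ?a0.
by rewrite -E; field; rewrite ?N0 ?a0.
Qed.

Lemma uniform_deck_pred (R : realType) m1 m2 (p : pred (deck m1 m2)) :
  uniform_deck R m1 m2 [set t | p t] = (#|p|%:R / #|{: deck m1 m2}|%:R)%:E.
Proof.
have countingE (q : pred (deck m1 m2)) :
    @counting (deck m1 m2) R [set t | q t] = #|q|%:R%:E.
  rewrite /counting asboolT; last exact: finite_finset.
  suff -> : fset_set [set t | q t] = [fset x in enum q]%fset.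
    by rewrite card_fseq undup_id ?enum_uniq// cardE.
  apply/fsetP => x; rewrite in_fset_set; last exact: finite_finset.
  by rewrite !inE mem_enum; apply/asboolP/idP.
have cT : @counting (deck m1 m2) R setT = #|{: deck m1 m2}|%:R%:E.
  by rewrite -(countingE xpredT); congr counting; apply/seteqP; split.
have n0 : (#|{: deck m1 m2}|%:R : R) != 0.
  by rewrite pnatr_eq0 -lt0n; apply/card_gt0P; exists (unshuffled m1 m2).
by rewrite /uniform_deck /= /mnormalize /= cT eqe (negbTE n0) /= countingE EFinM.
Qed.

Lemma cdf_matches (R : realType) m1 m2 (X : {RV (uniform_deck R m1 m2) >-> R})
    (x : R) k : (0 < m1)%N -> (m2 <= m1)%N ->
  (forall t, (X t <= x) = (matches t < k)%N) ->
  cdf X x = (1 - ties_tail R m1 m2 k)%:E.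
Proof.
move=> m10 m21 Xk; rewrite /cdf /distribution /pushforward /=.
have -> : X @^-1` `]-oo, x] = [set t | (matches t < k)%N].
  by apply/seteqP; split=> t /=; rewrite in_itv/= Xk.
rewrite uniform_deck_pred; congr EFin.
have cardT : #|{: deck m1 m2}| = 'C(m1 + m2, m1).
  have := card_deck_ties 0 m10 m21; rewrite expn0 mul1n subn0 => <-.
  by apply: eq_card.
have := cardC [pred t : deck m1 m2 | (k <= matches t)%N].
rewrite card_deck_ties// cardT => /(congr1 (fun n => n%:R : R)).
rewrite natrD tail_binomial// => CE.
have C0 : 'C(m1 + m2, m1)%:R != 0 :> R by rewrite pnatr_eq0 -lt0n bin_gt0; lia.
rewrite -[X in X - _](divff C0) -mulrBl -[X in (X - _) / _]CE addrAC subrr add0r.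
by congr (_%:R / _); apply: eq_card => t; rewrite !inE -ltnNge.
Qed.

(** Reduces a limit law to the limit of the tail: the event that c W is at most
    [x] says that W is at most the integer part of x / c. *)
Lemma cvg_in_distribution_tail (R : realType) (m2 : nat -> nat)
    (X : forall n, {RV (uniform_deck R n (m2 n)) >-> R})
    (c : nat -> R) (S : R -> R)
    (d : measure_display) (T : measurableType d) (Q : probability T R)
    (Y : {RV Q >-> R}) :
  (forall n, (m2 n <= n)%N) ->
  (forall n t, X n t = c n * (matches t)%:R) ->
  (\forall n \near \oo, 0 < c n) ->
  (forall x, x < 0 -> cdf Y x = 0%E) ->
  (forall x, 0 <= x -> cdf Y x = (1 - S x)%:E) ->
  (forall x, 0 <= x ->
    ties_tail R n (m2 n) (Num.truncn (x / c n)).+1 @[n --> \oo] --> S x) ->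
  cvg_in_distribution X Y.
Proof.
move=> m2n XE c0 Yneg Ypos tailS x _.
have [x0|x0] := ltP x 0.
  rewrite Yneg//; apply: (@cvg_trans _ (cst 0%E @ \oo)); last exact: cvg_cst.
  apply: near_eq_cvg; near=> n.
  have cn : 0 < c n by near: n.
  rewrite (@cdf_matches _ _ _ _ _ 0)//.
  - by rewrite /ties_tail big_ord0 subrr.
  - by near: n; exact: nbhs_infty_gt.
  - by move=> t; rewrite XE ltn0 leNgt (lt_le_trans x0)// mulr_ge0// ltW.
rewrite Ypos//; apply: (@cvg_trans _
    ((1 - ties_tail R n (m2 n) (Num.truncn (x / c n)).+1)%:E @[n --> \oo])).
  apply: near_eq_cvg; near=> n.
  have cn : 0 < c n by near: n.
  rewrite (@cdf_matches _ _ _ _ _ (Num.truncn (x / c n)).+1)//.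
    by near: n; exact: nbhs_infty_gt.
  by move=> t; rewrite XE mulrC -ler_pdivlMr// ltnS truncn_ge_nat// divr_ge0// ltW.
by apply: cvg_EFin; [exact: nearW|apply: cvgB; [exact: cvg_cst|exact: tailS]].
Unshelve. all: by end_near. Qed.

(** * Asymptotics of the tail *)

Lemma sum_shift (R : realType) (d : R) k :
  \sum_(j < k) (d + j%:R) = k%:R * d + k%:R * (k%:R - 1) / 2.
Proof.
elim: k => [|k IHk]; first by rewrite big_ord0; field.
by rewrite big_ord_recr/= IHk -[k.+1]addn1 natrD; field.
Qed.

(** Each factor is 1 - u with u = (d + j) / (m1 + m2 - j).  It is at most
    exp (- u); its inverse is 1 + (d + j) / (2 (m2 - j)), hence at most the
    exponential of that last fraction.  Replacing [j] in the denominators by its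
    extreme values 0 and [k] leaves the sum of the numerators d + j. *)
Lemma tail_bounds (R : realType) m1 m2 k (A : R) : (k < m2)%N -> (m2 <= m1)%N ->
  A = k%:R * (m1%:R - m2%:R) + k%:R * (k%:R - 1) / 2 ->
  expR (- (A / (2 * (m2%:R - k%:R)))) <= ties_tail R m1 m2 k
    <= expR (- (A / (m1%:R + m2%:R))).
Proof.
move=> km m21 ->; rewrite -sum_shift -!mulrN !mulr_suml !expR_sum.
have natb (j : 'I_k) : [/\ (j%:R : R) <= k%:R, (j%:R : R) >= 0,
    (k%:R : R) < m2%:R & (m2%:R : R) <= m1%:R].
  by rewrite ler_nat ltr_nat ler_nat ler0n; split=> //; exact: ltnW.
apply/andP; split; apply: ler_prod => j _; have [jk j0 k2 m12] := natb j;
  have jm : (j <= m2)%N by [lia|have := ltn_ord j; lia].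
- rewrite !natrB ?natrD//; last by lia.
  rewrite expR_ge0/= mulrN expRN.
  have -> : 2 * (m2%:R - j%:R) / (m1%:R + m2%:R - j%:R) =
     (1 + (m1%:R - m2%:R + j%:R) / (2 * (m2%:R - j%:R)))^-1 :> R.
    field.
    by rewrite !lt0r_neq0//; lra.
  have le_q : (m1%:R - m2%:R + j%:R) / (2 * (m2%:R - j%:R)) <=
     (m1%:R - m2%:R + j%:R) / (2 * (m2%:R - k%:R)) :> R.
    by rewrite ler_wpM2l// ?lef_pV2 ?posrE; lra.
  rewrite lef_pV2 ?posrE ?expR_gt0//; last first.
    by rewrite ltr_pwDl// divr_ge0//; lra.
  by apply: le_trans (expR_ge1Dx _); rewrite lerD2l.
- rewrite !natrB ?natrD//; last by lia.
  apply/andP; split; first by rewrite divr_ge0//; lra.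
  apply: le_trans (expR_ge1Dx _); rewrite mulrN.
  have -> : 2 * (m2%:R - j%:R) / (m1%:R + m2%:R - j%:R) =
     1 - (m1%:R - m2%:R + j%:R) / (m1%:R + m2%:R - j%:R) :> R.
    field.
    by rewrite !lt0r_neq0//; lra.
  by rewrite lerD2l lerN2 ler_wpM2l// ?lef_pV2 ?posrE; lra.
Qed.

(** Truncated subtraction of a constant is invisible at scale [n], also when
    the limit is 0 and [u n] may stay below the constant. *)
Lemma cvg_sub_const (R : realType) (u : nat -> nat) (l : R) j :
  ((u n)%:R / n%:R : R) @[n --> \oo] --> l ->
  ((u n - j)%:R / n%:R : R) @[n --> \oo] --> l.
Proof.
move=> ul; have jn0 : (j%:R / n%:R : R) @[n --> \oo] --> 0.
  rewrite -[0](mulr0 j%:R); apply: cvgMr.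
  apply/gtr0_cvgV0; last exact: cvgr_idn.
  by near=> n; rewrite ltr0n; near: n; exact: nbhs_infty_gt.
apply: (squeeze_cvgr (f := fun n => (u n)%:R / n%:R - j%:R / n%:R) _ _ ul).
  apply: nearW => n; rewrite -mulrBl !ler_wpM2r ?invr_ge0// ?ler_nat ?leq_subr//.
  by rewrite lerBlDr -natrD ler_nat; lia.
by rewrite -[l]subr0; exact: cvgB.
Unshelve. all: by end_near. Qed.

Lemma cvg_tail_geometric (R : realType) (m2 : nat -> nat) (rho : R) k :
  0 <= rho -> ((m2 n)%:R / n%:R : R) @[n --> \oo] --> rho ->
  ties_tail R n (m2 n) k @[n --> \oo] --> (2 * rho / (1 + rho)) ^+ k.
Proof.
move=> rho0 m2rho; elim: k => [|k IHk].
  by rewrite expr0; under eq_fun do rewrite /ties_tail big_ord0; exact: cvg_cst.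
rewrite exprSr; under eq_fun do rewrite /ties_tail big_ord_recr/=.
apply: cvgM => //.
have sumrho : ((n + m2 n)%:R / n%:R : R) @[n --> \oo] --> 1 + rho.
  apply: (@cvg_trans _ ((1 + (m2 n)%:R / n%:R : R) @[n --> \oo])).
    apply: near_eq_cvg; near=> n.
    rewrite natrD mulrDl divff// pnatr_eq0 -lt0n.
    by near: n; exact: nbhs_infty_gt.
  by apply: cvgD => //; exact: cvg_cst.
apply: (@cvg_trans _ ((2 * ((m2 n - k)%:R / n%:R) /
    ((n + m2 n - k)%:R / n%:R) : R) @[n --> \oo])).
  apply: near_eq_cvg; near=> n.
  have n0 : n%:R != 0 :> R.
    by rewrite pnatr_eq0 -lt0n; near: n; exact: nbhs_infty_gt.
  by rewrite invf_div mulrA mulrA divfK.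
apply: cvgM; first by apply: cvgMr; exact: cvg_sub_const.
apply: cvgV; first by rewrite gt_eqF// ltr_wpDr.
exact: cvg_sub_const.
Unshelve. all: by end_near. Qed.

(** The asymptotics of all the regimes with m2 equivalent to m1.  Since [s]
    tends to infinity, the two limits force d, s and hence k to be negligible
    with respect to n, so that both denominators of [tail_bounds] are equivalent
    to 2 n; the numerator k d + k (k - 1) / 2, divided by n, tends to
    a x + b x ^ 2 / 2. *)
Lemma cvg_tail_scaled (R : realType) (m2 : nat -> nat) (s : nat -> R) (a b x : R) :
  (forall n, (m2 n <= n)%N) -> 0 <= x ->
  s n @[n --> \oo] --> +oo ->
  (s n * (n%:R - (m2 n)%:R) / n%:R) @[n --> \oo] --> a ->
  (s n ^+ 2 / n%:R) @[n --> \oo] --> b ->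
  ties_tail R n (m2 n) (Num.truncn (x * s n)).+1 @[n --> \oo]
    --> expR (- (a * x / 2 + b * x ^+ 2 / 4)).
Proof.
move=> m2n x0 sy sda ssb.
pose k n := (Num.truncn (x * s n)).+1.
have n0 : \forall n \near \oo, n%:R != 0 :> R.
  by near=> n; rewrite pnatr_eq0 -lt0n; near: n; exact: nbhs_infty_gt.
have s0 : \forall n \near \oo, 0 < s n by move/cvgryPgt : sy; exact.
have sV : (s n)^-1 @[n --> \oo] --> 0 by apply/gtr0_cvgV0.
have ks : ((k n)%:R / s n) @[n --> \oo] --> x.
  apply: (squeeze_cvgr (f := cst x) (h := fun n => x + (s n)^-1)).
  - near=> n; have sn : 0 < s n by near: n.
    have /andP[t1 t2] := @truncn_itv _ (x * s n) (mulr_ge0 x0 (ltW sn)).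
    rewrite ler_pdivlMr// (ltW t2)/= ler_pdivrMr// mulrDl mulVf ?gt_eqF//.
    by rewrite /k -addn1 natrD lerD2r.
  - exact: cvg_cst.
  - by rewrite -[X in _ --> X]addr0; apply: cvgD => //; exact: cvg_cst.
have kn : ((k n)%:R / n%:R) @[n --> \oo] --> (0 : R).
  apply: (@cvg_trans _
      (((k n)%:R / s n * (s n ^+ 2 / n%:R) * (s n)^-1) @[n --> \oo])).
    apply: near_eq_cvg; near=> n.
    have sn : s n != 0 by rewrite gt_eqF//; near: n.
    by field; rewrite sn andbT; near: n.
  by rewrite -(mulr0 (x * b)); apply: cvgM => //; exact: cvgM.
have m2n1 : ((m2 n)%:R / n%:R) @[n --> \oo] --> (1 : R).
  apply: (@cvg_trans _
      ((1 - s n * (n%:R - (m2 n)%:R) / n%:R * (s n)^-1) @[n --> \oo])).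
    apply: near_eq_cvg; near=> n.
    have sn : s n != 0 by rewrite gt_eqF//; near: n.
    by field; rewrite sn andbT; near: n.
  have := cvgB (cvg_cst (1 : R)) (cvgM sda sV); rewrite mulr0 subr0; exact.
have km2 : \forall n \near \oo, (k n < m2 n)%N.
  (* (m2 - k) / n tends to 1 - 0, and any positive bound below it will do. *)
  have half1 : 2^-1 < 1 - 0 :> R by lra.
  near=> n; rewrite -(ltr_nat R) -subr_gt0.
  have : 2^-1 < (m2 n)%:R / n%:R - (k n)%:R / n%:R :> R.
    by near: n; apply: cvgr_gt half1; exact: cvgB.
  rewrite -mulrBl => /(lt_trans _) => /(_ 0).
  by rewrite invr_gt0 ltr0n pmulr_lgt0 ?invr_gt0 ?ltr0n;
    [apply|near: n; exact: nbhs_infty_gt].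
pose A n : R := (k n)%:R * (n%:R - (m2 n)%:R) + (k n)%:R * ((k n)%:R - 1) / 2.
have An : (A n / n%:R) @[n --> \oo] --> x * a + x * (x - 0) / 2 * b.
  apply: (@cvg_trans _ (((k n)%:R / s n * (s n * (n%:R - (m2 n)%:R) / n%:R) +
    (k n)%:R / s n * ((k n)%:R / s n - (s n)^-1) / 2 * (s n ^+ 2 / n%:R)) @[n --> \oo])).
    apply: near_eq_cvg; near=> n.
    have sn : s n != 0 by rewrite gt_eqF//; near: n.
    by rewrite /A; field; rewrite sn andbT; near: n.
  apply: cvgD; first exact: cvgM.
  by apply: cvgM => //; apply: cvgMl; apply: cvgM => //; exact: cvgB.
have expE : x * a + x * (x - 0) / 2 * b = 2 * (a * x / 2 + b * x ^+ 2 / 4).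
  by field.
rewrite expE in An.
have cvg_expR (u : nat -> R) (l : R) : u n @[n --> \oo] --> l ->
    expR (u n) @[n --> \oo] --> expR l.
  by move=> ul; apply: cvg_comp ul _; exact: continuous_expR.
apply: (squeeze_cvgr (f := fun n => expR (- (A n / (2 * ((m2 n)%:R - (k n)%:R)))))
    (h := fun n => expR (- (A n / (n%:R + (m2 n)%:R))))).
- near=> n; apply: tail_bounds => //; near: n; exact: km2.
- apply: cvg_expR; apply: cvgN; apply: (@cvg_trans _
      ((A n / n%:R / (2 * ((m2 n)%:R / n%:R - (k n)%:R / n%:R))) @[n --> \oo])).
    apply: near_eq_cvg; near=> n.
    have nn0 : n%:R != 0 :> R by near: n.
    by rewrite -mulrBl mulrA invf_div mulrA divfK.
  (* L written as the quotient of the limits of A / n and 2 (m2 - k) / n. *)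
  set L := _ + _ in An *; have -> : L = 2 * L / (2 * (1 - 0)) by field.
  apply: cvgM => //; apply: cvgV; first by rewrite subr0 mulr1.
  by apply: cvgMr; exact: cvgB.
- apply: cvg_expR; apply: cvgN; apply: (@cvg_trans _
      ((A n / n%:R / (1 + (m2 n)%:R / n%:R)) @[n --> \oo])).
    apply: near_eq_cvg; near=> n.
    have nn0 : n%:R != 0 :> R by near: n.
    by rewrite -[X in X + _ / _](divff nn0) -mulrDl invf_div mulrA divfK.
  set L := _ + _ in An *; have -> : L = 2 * L / (1 + 1) by field.
  apply: cvgM => //; apply: cvgV => //.
  by apply: cvgD => //; exact: cvg_cst.
Unshelve. all: by end_near.
Qed.

(** * From Landau notations to limits of ratios *)

(** Where [g] vanishes, the domination makes [f] vanish too, and the ratio is 0. *)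
Lemma eqo_ratio (R : realType) (f g : nat -> R^o) :
  f =o_\oo g -> (f n / g n : R) @[n --> \oo] --> (0 : R).
Proof.
move/eqoP => fg; apply/cvgrPdist_le => e e0; near=> n.
rewrite sub0r normrN normf_div.
have : `|f n| <= e * `|g n| by near: n; exact: fg.
have [->|g0] := eqVneq (g n) 0;
  first by rewrite normr0 invr0 !mulr0 => _; exact: ltW.
by rewrite ler_pdivrMr// normr_gt0.
Unshelve. all: by end_near. Qed.

Lemma equiv_ratio (R : realType) (f g : nat -> R^o) :
  (\forall n \near \oo, g n != 0) ->
  f ~_\oo g -> (f n / g n : R) @[n --> \oo] --> (1 : R).
Proof.
move=> g0 /eqaddoP fg.
have /eqo_ratio fg0 : (f - g) =o_\oo g by apply/eqoP.
apply: (@cvg_trans _ (((f - g) n / g n + 1 : R) @[n --> \oo])); last first.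
  by have := cvgD fg0 (cvg_cst (1 : R)); rewrite add0r; exact.
apply: near_eq_cvg; near=> n.
have gn0 : g n != 0 by near: n.
by rewrite mulrBl divff// subrK.
Unshelve. all: by end_near. Qed.

(** * The limit laws *)

Section limit_laws.
Context (R : realType).

Fact half_gt0 : 0 < 1 / 2 :> R. Proof. by rewrite divr_gt0. Qed.

(** That [exponential_prob] is a probability depends on the positivity of the
    rate, which inference cannot supply; hence the explicit instance. *)
Definition exp_half_prob : probability (measurableTypeR R) R :=
  exponential_distribution_exponential_prob__canonical__probability_measure_Probability half_gt0.

Lemma exp_half_prob_ray (x : R) : exp_half_prob `]-oo, x]%classic =
  (if 0 <= x then 1 - expR (- (x / 2)) else 0)%:E.
Proof.
have Qneg : exp_half_prob `]-oo, 0[%classic = 0%E.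
  apply: integral0_eq => e /=; rewrite in_itv/= => e0.
  by rewrite /exponential_pdf patchE ifF// memNset//= in_itv/= andbT leNgt e0.
case: ifPn => [|/negP]; last first.
  move=> x0; apply/eqP; rewrite eq_le measure_ge0 andbT -[leRHS]Qneg.
  apply: le_measure; [apply/mem_set; exact: measurable_itv..|] => e /=.
  rewrite !in_itv/= => ex.
  by apply: le_lt_trans ex _; rewrite ltNge; apply/negP.
rewrite le_eqVlt => /predU1P[<-|x0].
  rewrite mul0r oppr0 expR0 subrr.
  have -> : `]-oo, (0 : R)]%classic = `]-oo, (0:R)[%classic `|` [set 0].
    apply/seteqP; split=> e /=; rewrite !in_itv/=; last by case=> [/ltW|->].
    by rewrite le_eqVlt => /orP[/eqP ->|]; [right|left].
  rewrite measureU.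
  - by rewrite [X in (X + _)%E]Qneg add0e [LHS]integral_set1.
  - exact: measurable_itv.
  - exact: measurable_set1.
  - by apply/seteqP; split=> e //= []; rewrite in_itv/= => /[swap] ->; rewrite ltxx.
have -> : `]-oo, x]%classic = `]-oo, (0:R)[%classic `|` `[0, x]%classic.
  apply/seteqP; split=> e /=; rewrite !in_itv/=.
    by move=> ex; have [e0|e0] := ltP e 0; [left|right; rewrite ex].
  by case=> [/ltW e0|/andP[]//]; exact: le_trans e0 (ltW x0).
rewrite measureU.
- rewrite [X in (X + _)%E]Qneg add0e [LHS](exponential_prob_itv0c (1 / 2) x0).
  by rewrite EFinB; congr (_ - (expR _)%:E)%E; lra.
- exact: measurable_itv.
- exact: measurable_itv.
- by apply/seteqP; split=> e //= []; rewrite !in_itv/= ltNge => /negP e0 /andP[].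
Qed.

Fact nd_measurable (f : R -> R) (nd : {homo f : x y / x <= y}) :
  @measurable_fun _ _ (measurableTypeR R) R setT f.
Proof. exact: nondecreasing_measurable. Qed.

(** Nondecreasing functions are measurable, and their distribution functions are
    read off the one of [exp_half_prob] ([cdf_nd_RV]). *)
Definition nd_RV (f : R -> R) (nd : {homo f : x y / x <= y}) :
    {RV exp_half_prob >-> R} :=
  HB.pack f
    (@isMeasurableFun.Build _ _ (measurableTypeR R) R f (nd_measurable nd)).

Lemma cdf_nd_RV (f : R -> R) (nd : {homo f : x y / x <= y}) (x y : R) :
  (forall e, (f e <= x) = (e <= y)) ->
  cdf (nd_RV nd) x = (if 0 <= y then 1 - expR (- (y / 2)) else 0)%:E.
Proof.
move=> fxy; rewrite -exp_half_prob_ray /cdf /distribution /pushforward /=.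
by congr (exp_half_prob _); apply/seteqP; split=> e /=; rewrite !in_itv/= fxy.
Qed.

(** The root t of t (2 alpha + t) = 2 e.  It exceeds x exactly when the
    exponential variable e of rate 1/2 exceeds x (2 alpha + x) / 2, which has
    probability exp (- x (2 alpha + x) / 4). *)
Definition parabola_root (alpha e : R) : R :=
  Num.sqrt (alpha ^+ 2 + 2 * e) - alpha.

Lemma parabola_root_nd alpha : {homo parabola_root alpha : x y / x <= y}.
Proof. by move=> x y xy; rewrite lerD2r ler_wsqrtr// lerD2l ler_pM2l. Qed.

Lemma parabola_root_le alpha x e : 0 <= alpha -> 0 <= x ->
  (parabola_root alpha e <= x) = (e <= x * (2 * alpha + x) / 2).
Proof.
move=> a0 x0; rewrite lerBlDr.
have -> : x + alpha = Num.sqrt ((x + alpha) ^+ 2)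
  by rewrite sqrtr_sqr ger0_norm// addr_ge0.
rewrite [LHS]leNgt [RHS]leNgt; congr (~~ _).
have [p0|p0] := ltP 0 (alpha ^+ 2 + 2 * e).
  by rewrite ltr_sqrt//; apply/idP/idP; nra.
rewrite (ler0_sqrtr p0) [LHS]ltNge sqrtr_ge0/=.
apply/esym/negbTE; rewrite -leNgt; nra.
Qed.

Definition linexp alpha : {RV exp_half_prob >-> R} := nd_RV (@parabola_root_nd alpha).

Lemma cdf_linexp alpha x : 0 <= alpha -> 0 <= x ->
  cdf (linexp alpha) x = (1 - expR (- (x * (2 * alpha + x) / 4)))%:E.
Proof.
move=> a0 x0; rewrite (cdf_nd_RV _ (fun e => parabola_root_le e a0 x0)).
rewrite ifT; last by rewrite divr_ge0// mulr_ge0//; lra.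
by congr (1 - expR _)%:E; field.
Qed.

Lemma cdf_le0 d (T : measurableType d) (Q : probability T R)
    (X : {RV Q >-> R}) (x y : R) :
  cdf X y = 0%E -> x <= y -> cdf X x = 0%E.
Proof.
move=> Xy xy; apply/eqP; rewrite eq_le cdf_ge0 andbT -[leRHS]Xy.
exact: cdf_nondecreasing.
Qed.

Lemma cdf_linexp_lt0 alpha x : 0 <= alpha -> x < 0 -> cdf (linexp alpha) x = 0%E.
Proof.
move=> a0 /ltW x0; apply: cdf_le0 x0.
by rewrite cdf_linexp// !mul0r oppr0 expR0 subrr.
Qed.

Definition ceil_mul (r e : R) : R := (Num.ceil (e * r))%:~R.

Lemma ceil_mul_nd r : 0 <= r -> {homo ceil_mul r : x y / x <= y}.
Proof. by move=> r0 x y xy; rewrite ler_int le_ceil// ler_wpM2r. Qed.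

Lemma ceil_mul_le (r : R) (m : nat) (x e : R) : 0 < r -> m%:R <= x < m.+1%:R ->
  (ceil_mul r e <= x) = (e <= m%:R / r).
Proof.
move=> r0 /andP[mx xm]; rewrite ler_pdivlMr// (_ : m%:R = (Posz m)%:~R)//.
rewrite -ceil_le_int; apply/idP/idP => [cx|].
  rewrite -ltzD1 -(ltr_int R) (le_lt_trans cx)// (lt_le_trans xm)//.
  by rewrite -natr1 intrD.
by rewrite -(ler_int R) => /le_trans; exact.
Qed.

(** Rounding up an exponential variable gives a geometric one.  The variable is
    multiplied by r = - 1 / (2 ln q) first: the product exceeds m with
    probability exp (- m / (2 r)) = q ^ m. *)
Lemma geometric_exists (q : R) : 0 < q < 1 ->
  exists G X : {RV exp_half_prob >-> R}, [/\ Geom G (1 - q), forall t, X t = G t - 1,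
    forall k : nat, pmf X k%:R = (1 - q) * q ^+ k,
    forall x, x < 0 -> cdf X x = 0%E &
    forall x, 0 <= x -> cdf X x = (1 - q ^+ (Num.truncn x).+1)%:E].
Proof.
move=> /andP[q0 q1].
have lnq : ln q < 0 by rewrite ln_lt0// q0.
pose r := - (2 * ln q)^-1.
have r0 : 0 < r by rewrite oppr_gt0 invr_lt0 pmulr_rlt0.
pose G := nd_RV (ceil_mul_nd (ltW r0)).
have X_nd : {homo (fun e => ceil_mul r e - 1) : x y / x <= y}.
  by move=> x y xy; rewrite lerD2r ceil_mul_nd// ltW.
pose X := nd_RV X_nd.
have cdfG (m : nat) x : m%:R <= x < m.+1%:R -> cdf G x = (1 - q ^+ m)%:E.
  move=> mx; rewrite (cdf_nd_RV _ (fun e => ceil_mul_le e r0 mx)).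
  rewrite ifT; last by rewrite divr_ge0// ltW.
  have -> : - (m%:R / r / 2) = m%:R * ln q.
    by rewrite /r invrN invrK; field.
  by rewrite expRM_natl lnK// posrE.
have cdfX x : cdf X x = cdf G (x + 1).
  rewrite /cdf /distribution /pushforward /=; congr (exp_half_prob _).
  by apply/seteqP; split=> e /=; rewrite !in_itv/= lerBlDr.
have pmfG (l : nat) : pmf G l.+1%:R = (1 - q) * q ^+ l.
  have splitG : G @^-1` `]-oo, l.+1%:R] =
      G @^-1` `]-oo, l%:R] `|` G @^-1` [set l.+1%:R].
    apply/seteqP; split=> e /=; rewrite !in_itv/=; last first.
      by case=> [/le_trans|->//]; apply; rewrite ler_nat.
    rewrite /ceil_mul => cl.
    have [ce|ce] := leP (Num.ceil (e * r))%:~R (l%:R : R).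
      by left.
    right; apply/eqP; rewrite eq_le cl/=.
    move: ce; rewrite -[l%:R]/((Posz l)%:~R) -[l.+1%:R]/((Posz l.+1)%:~R).
    by rewrite ltr_int ler_int; lia.
  have mG (A : set R) : measurable A -> measurable (G @^-1` A).
    by move=> mA; rewrite -[_ @^-1` _]setTI; exact: measurable_funP.
  have cdfQ m : exp_half_prob (G @^-1` `]-oo, m%:R]) = (1 - q ^+ m)%:E.
    by apply: cdfG; rewrite lexx ltr_nat ltnSn.
  have := cdfQ l.+1; rewrite splitG.
  have -> : exp_half_prob (G @^-1` `]-oo, l%:R] `|` G @^-1` [set l.+1%:R]) =
      (exp_half_prob (G @^-1` `]-oo, l%:R]) + exp_half_prob (G @^-1` [set l.+1%:R]))%E.
    apply: measureU.
    - by apply: mG; exact: measurable_itv.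
    - by apply: mG; exact: measurable_set1.
    - apply/seteqP; split=> e //= []; rewrite in_itv/= => /[swap] ->.
      by rewrite ler_nat ltnn.
  have fQ : exp_half_prob (G @^-1` [set l.+1%:R]) \is a fin_num.
    by apply: fin_num_measure; apply: mG; exact: measurable_set1.
  rewrite cdfQ -(fineK fQ) -EFinD exprS => E; have := EFin_inj E.
  rewrite -[fine _]/(pmf G l.+1%:R) => {}E; lra.
exists G, X; split.
- by case=> // l _; rewrite pmfG subn1/= subKr.
- by [].
- move=> k; rewrite -pmfG /pmf; congr (fine (exp_half_prob _)).
  apply/seteqP; split=> e /=; rewrite -natr1 => E.
    by rewrite -E subrK.
  by rewrite E addrK.
(* [cdfG 0] covers [-1, 0[; monotonicity takes care of the values below -1. *)
- move=> x x0; apply: (@cdf_le0 _ _ _ X _ (Num.max x (-1)));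
    last by rewrite le_max lexx.
  rewrite cdfX (cdfG 0)//; first by rewrite expr0 subrr.
  by rewrite -lerBlDr sub0r le_max lexx orbT/= -ltrBrDr subrr gt_max x0 ltrN10.
- move=> x x0; rewrite cdfX; apply: cdfG.
  by have /andP[h1 h2] := truncn_itv x0;
    rewrite -natr1 -[in X in _ < X]natr1 lerD2r ltrD2r h1.
Qed.

End limit_laws.

(** * The regimes *)

Lemma cvg_sqrt_nat (R : realType) : (Num.sqrt n%:R : R) @[n --> \oo] --> +oo.
Proof.
apply/cvgryPge => A; near=> n.
have [A0|/ltW A0] := leP 0 A; last exact: le_trans A0 (sqrtr_ge0 _).
rewrite -(ger0_norm A0) -sqrtr_sqr ler_wsqrtr//; near: n.
by move/cvgryPge : (@cvgr_idn R); exact.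
Unshelve. all: by end_near. Qed.

(** The scale s = sqrt n, for which s d / n = d / sqrt n and s ^ 2 / n = 1. *)
Lemma cvg_sqrt_regime (R : realType) (m2 : nat -> nat) (alpha : R) :
  (forall n, (m2 n <= n)%N) -> 0 <= alpha ->
  ((n%:R - (m2 n)%:R) / Num.sqrt n%:R : R) @[n --> \oo] --> alpha ->
  cvg_in_distribution
    (fun n => scale_RV (W R n (m2 n)) (Num.sqrt n%:R)^-1) (linexp alpha).
Proof.
move=> m2n a0 dalpha.
apply: (@cvg_in_distribution_tail _ _ _ (fun n => (Num.sqrt n%:R)^-1)
    (fun x => expR (- (x * (2 * alpha + x) / 4)))) => //.
- near=> n; rewrite invr_gt0 sqrtr_gt0 ltr0n; near: n; exact: nbhs_infty_gt.
- by move=> x; exact: cdf_linexp_lt0.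
- by move=> x; exact: cdf_linexp.
move=> x x0; under eq_fun do rewrite invrK.
have -> : x * (2 * alpha + x) / 4 = alpha * x / 2 + 1 * x ^+ 2 / 4 by field.
apply: (cvg_tail_scaled m2n x0 (@cvg_sqrt_nat R)).
  apply: cvg_trans dalpha; apply: near_eq_cvg; near=> n.
  have s0 : Num.sqrt n%:R != 0 :> R.
    by rewrite sqrtr_eq0 lern0 -lt0n; near: n; exact: nbhs_infty_gt.
  have nE e : e / n%:R = e / Num.sqrt n%:R ^+ 2 :> R by rewrite sqr_sqrtr.
  by rewrite nE; field.
apply: (@cvg_trans _ (cst (1 : R) @ \oo)); last exact: cvg_cst.
apply: near_eq_cvg; near=> n.
rewrite sqr_sqrtr ?ler0n// divff// pnatr_eq0 -lt0n; near: n; exact: nbhs_infty_gt.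
Unshelve. all: by end_near. Qed.

(** The scale s = n / d, for which s d / n = 1 and
    s ^ 2 / n = (sqrt n / d) ^ 2. *)
Lemma cvg_inverse_gap_regime (R : realType) (m2 : nat -> nat) d
    (T : measurableType d)
    (Q : probability T R) (X : {RV Q >-> R}) :
  (forall n, (m2 n <= n)%N) ->
  (\forall n \near \oo, 0 < n%:R - (m2 n)%:R :> R) ->
  (Num.sqrt n%:R / (n%:R - (m2 n)%:R) : R) @[n --> \oo] --> (0 : R) ->
  ((n%:R - (m2 n)%:R) / n%:R : R) @[n --> \oo] --> (0 : R) ->
  (forall x, x < 0 -> cdf X x = 0%E) ->
  (forall x, 0 <= x -> cdf X x = (1 - expR (- (x / 2)))%:E) ->
  cvg_in_distribution
    (fun n => scale_RV (W R n (m2 n)) ((n%:R - (m2 n)%:R) / n%:R)) X.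
Proof.
move=> m2n d0 sd dn Xneg Xpos.
have dn0 : \forall n \near \oo, 0 < (n%:R - (m2 n)%:R) / n%:R :> R.
  near=> n; rewrite divr_gt0//; first by near: n.
  by rewrite ltr0n; near: n; exact: nbhs_infty_gt.
apply: (cvg_in_distribution_tail (c := fun n => (n%:R - (m2 n)%:R) / n%:R)
  m2n _ dn0 Xneg Xpos) => //.
move=> x x0; have -> : x / 2 = 1 * x / 2 + 0 * x ^+ 2 / 4 by field.
apply: (cvg_tail_scaled (s := fun n => ((n%:R - (m2 n)%:R) / n%:R)^-1) m2n x0).
- by apply/cvgrVy.
- apply: (@cvg_trans _ (cst (1 : R) @ \oo)); last exact: cvg_cst.
  apply: near_eq_cvg; near=> n.
  rewrite -mulrA mulVf// gt_eqF//; near: n; exact: dn0.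
- apply: (@cvg_trans _
      (((Num.sqrt n%:R / (n%:R - (m2 n)%:R)) ^+ 2 : R) @[n --> \oo]));
    last by rewrite -(mulr0 0); under eq_fun do rewrite expr2; exact: (cvgM sd sd).
  apply: near_eq_cvg; near=> n.
  have n0 : n%:R != 0 :> R by rewrite pnatr_eq0 -lt0n; near: n; exact: nbhs_infty_gt.
  have dn0' : n%:R - (m2 n)%:R != 0 :> R by rewrite gt_eqF//; near: n.
  rewrite expr_div_n sqr_sqrtr ?ler0n//.
  by field; rewrite n0.
Unshelve. all: by end_near. Qed.

(** For rho = 0 the limit is the constant 0: its tail is the power
    0 ^ (trunc x + 1) = 0. *)
Lemma cvg_geometric_regime (R : realType) (m2 : nat -> nat) (rho : R) d
    (T : measurableType d)
    (Q : probability T R) (X : {RV Q >-> R}) :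
  (forall n, (m2 n <= n)%N) -> 0 <= rho ->
  ((m2 n)%:R / n%:R : R) @[n --> \oo] --> rho ->
  (forall x, x < 0 -> cdf X x = 0%E) ->
  (forall x, 0 <= x ->
    cdf X x = (1 - (2 * rho / (1 + rho)) ^+ (Num.truncn x).+1)%:E) ->
  cvg_in_distribution (fun n => W R n (m2 n)) X.
Proof.
move=> m2n rho0 m2rho Xneg Xpos.
apply: (cvg_in_distribution_tail (c := cst 1) m2n _ _ Xneg Xpos).
- by move=> n t; rewrite mul1r.
- exact: nearW.
- by move=> x x0; rewrite /cst divr1; exact: cvg_tail_geometric.
Qed.

Theorem theorem6 (R : realType) (m2 : nat -> nat)
    (m2_le : forall m1 : nat, (m2 m1 <= m1)%N) :
  let d : nat -> R^o := fun m1 => m1%:R - (m2 m1)%:R in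
  let m1R : nat -> R^o := fun m1 => m1%:R in
  let m2R : nat -> R^o := fun m1 => (m2 m1)%:R in
  let sqrt_m1 : nat -> R^o := fun m1 => Num.sqrt m1%:R in
  (* (1) *)
  (m2R =o_\oo m1R ->
    forall (e : measure_display) (T : measurableType e) (Q : probability T R),
      cvg_in_distribution (fun m1 => W R m1 (m2 m1))
        (cst 0 : {RV Q >-> R})) /\
  (* (2) *)
  (forall rho : R, 0 < rho < 1 -> m2R ~_\oo (fun m1 => rho * m1R m1) ->
    exists (e : measure_display) (T : measurableType e) (Q : probability T R)
        (G X : {RV Q >-> R}),
      Geom G ((1 - rho) / (1 + rho)) /\ (forall t : T, X t = G t - 1) /\
      (forall k : nat,
        pmf X k%:R = (1 - rho) / (1 + rho) * (2 * rho / (1 + rho)) ^+ k) /\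
      cvg_in_distribution (fun m1 => W R m1 (m2 m1)) X) /\
  (* (3) *)
  (m2R ~_\oo m1R -> sqrt_m1 =o_\oo d -> d =o_\oo m1R ->
    exists (e : measure_display) (T : measurableType e) (Q : probability T R)
        (X : {RV Q >-> R}),
      Exp X (1 / 2) /\
      (forall x : R, 0 < x -> cdf X x = (1 - expR (- (x / 2)))%:E) /\
      cvg_in_distribution
        (fun m1 => scale_RV (W R m1 (m2 m1)) (d m1 / m1%:R)) X) /\
  (* (4) *)
  (forall alpha : R, 0 < alpha ->
    m2R ~_\oo m1R -> d ~_\oo (fun m1 => alpha * sqrt_m1 m1) ->
    exists (e : measure_display) (T : measurableType e) (Q : probability T R)
        (X : {RV Q >-> R}),
      LinExp X (alpha / 2) (1 / 2) /\
      (forall x : R, 0 < x ->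
        cdf X x = (1 - expR (- (x * (2 * alpha + x) / 4)))%:E) /\
      cvg_in_distribution
        (fun m1 => scale_RV (W R m1 (m2 m1)) (Num.sqrt m1%:R)^-1) X) /\
  (* (5) *)
  (m2R ~_\oo m1R -> d =o_\oo sqrt_m1 ->
    exists (e : measure_display) (T : measurableType e) (Q : probability T R)
        (X : {RV Q >-> R}),
      Rayleigh X (Num.sqrt 2) /\
      (forall x : R, 0 < x -> cdf X x = (1 - expR (- (x ^+ 2 / 4)))%:E) /\
      cvg_in_distribution
        (fun m1 => scale_RV (W R m1 (m2 m1)) (Num.sqrt m1%:R)^-1) X).
Proof.
move=> d m1R m2R sqrt_m1.
have n_gt0 : \forall n \near \oo, 0 < n%:R :> R.
  by near=> n; rewrite ltr0n; near: n; exact: nbhs_infty_gt.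
have sqrt_gt0 : \forall n \near \oo, 0 < Num.sqrt n%:R :> R.
  by near=> n; rewrite sqrtr_gt0; near: n.
split; [|split; [|split; [|split]]].
- move=> /eqo_ratio m2o e T Q; apply: (cvg_geometric_regime m2_le (lexx 0)) => //.
  + move=> x x0; rewrite /cdf /distribution /pushforward preimage_cst memNset ?measure0//.
    by rewrite /= in_itv/= leNgt x0.
  + move=> x x0; rewrite /cdf /distribution /pushforward preimage_cst mem_set; last first.
      by rewrite /= in_itv.
    by rewrite probability_setT mulr0 mul0r exprS mul0r subr0.
- move=> rho /andP[rho0 rho1] m2rho.
  have q01 : 0 < 2 * rho / (1 + rho) < 1.
    by rewrite divr_gt0 ?ltr_pdivrMr//; lra.
  have [G [X [GG XG Xpmf Xneg Xpos]]] := geometric_exists q01.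
  have pE : 1 - 2 * rho / (1 + rho) = (1 - rho) / (1 + rho).
    by field; rewrite gt_eqF//; lra.
  rewrite pE in GG Xpmf.
  exists _, _, (exp_half_prob R), G, X; split=> //; split=> //; split=> //.
  apply: (cvg_geometric_regime m2_le (ltW rho0)) => //.
  have g0 : \forall n \near \oo, rho * m1R n != 0.
    near=> n; rewrite mulf_neq0 ?gt_eqF//; near: n; exact: n_gt0.
  apply: (@cvg_trans _
    ((rho * (m2R n / (rho * m1R n)) : R) @[n --> \oo])); last first.
    by have := cvgMr (a := rho) (equiv_ratio g0 m2rho); rewrite mulr1; exact.
  apply: near_eq_cvg; near=> n.
  have n0 : n%:R != 0 :> R by rewrite gt_eqF//; near: n.
  by rewrite /m2R /m1R; field; rewrite n0 gt_eqF.
- move=> _ so od.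
  pose X : {RV (exp_half_prob R) >-> R} := nd_RV (fun x y xy => xy : id x <= id y).
  have Xpos x : 0 <= x -> cdf X x = (1 - expR (- (x / 2)))%:E.
    by move=> x0; rewrite (cdf_nd_RV _ (y := x)) ?x0.
  have Xneg x : x < 0 -> cdf X x = 0%E.
    by move=> x0; rewrite (cdf_nd_RV _ (y := x)) 1?leNgt ?x0.
  exists _, _, (exp_half_prob R), X; split; first by move=> A mA.
  split; first by move=> x /ltW; exact: Xpos.
  apply: cvg_inverse_gap_regime => //.
  + near=> n; rewrite lt_def subr_ge0 ler_nat m2_le andbT; apply/eqP => d0.
    (* The domination of sqrt n > 0 by d excludes d = 0. *)
    have : `|sqrt_m1 n| <= 1 * `|d n|.
      by near: n; move/eqoP : so; apply.
    rewrite /d d0 normr0 mulr0 normr_le0 gt_eqF//; near: n; exact: sqrt_gt0.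
  + exact: (eqo_ratio so).
  + exact: (eqo_ratio od).
- move=> alpha alpha0 _ dalpha.
  exists _, _, (exp_half_prob R), (linexp alpha); split; [|split].
  + move=> x x0; rewrite cdf_linexp ?(ltW alpha0) ?(ltW x0)//.
    by congr (1 - expR _)%:E; field.
  + by move=> x x0; rewrite cdf_linexp// ltW.
  + apply: cvg_sqrt_regime => //; first exact: ltW.
    have g0 : \forall n \near \oo, alpha * sqrt_m1 n != 0.
      near=> n; rewrite mulf_neq0 ?gt_eqF//; near: n; exact: sqrt_gt0.
    apply: (@cvg_trans _
      ((alpha * (d n / (alpha * sqrt_m1 n)) : R) @[n --> \oo])); last first.
      by have := cvgMr (a := alpha) (equiv_ratio g0 dalpha); rewrite mulr1; exact.
    apply: near_eq_cvg; near=> n.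
    have s0 : Num.sqrt n%:R != 0 :> R by rewrite gt_eqF//; near: n.
    by rewrite /d /sqrt_m1; field; rewrite s0 gt_eqF.
- move=> _ od.
  exists _, _, (exp_half_prob R), (linexp 0); split; [|split].
  + move=> x x0; rewrite cdf_linexp ?(ltW x0)// mulr0 add0r sqr_sqrtr//.
    by congr (1 - expR _)%:E; field.
  + by move=> x x0; rewrite cdf_linexp ?(ltW x0)// mulr0 add0r -expr2.
  + by apply: cvg_sqrt_regime => //; exact: (eqo_ratio od).
Unshelve. all: by end_near. Qed.
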